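(* Let $X$ be a Hilbert space and let $\mathcal{A}$ be a self-adjoint operator in $X$ with $-\mathcal{A}$ positive, having a complete orthonormal set of eigenfunctions $(\phi_j)_{j\in\mathbb{N}}$ corresponding to eigenvalues $(\tilde\lambda_j)_{j\in\mathbb{N}}$ with $\tilde\lambda_j\to-\infty$ as $j\to\infty$. Let $\tau>0$, $\varepsilon>0$, and let $\alpha\in(-\infty,1)$. Then the problem $$\begin{aligned} \partial_t u(t)&=\mathcal{A}u(t-\tau)-\varepsilon(-\mathcal{A})^\alpha u(t),\quad t>0, \\ u(0)&=u_0\in(X,D(\mathcal{A}))_{1/2,2}, \\ u(t)&=\varphi(t)\quad\text{for }t\in(-\tau,0),\quad\varphi\in L^2\big((-\tau,0),D(\mathcal{A})\big) \end{aligned}$$ is ill-posed. That is, there exist solutions $(u_j)_{j\in\mathbb{N}}$ such that, for any fixed $t>0$, the norm $\|u_j(t)\|_X$ tends to infinity as $j\to\infty$, while the norm of the data $(u_j(0),\varphi_j)$ in $X\times L^2((-\tau,0),X)$, with $\varphi_j:=u_j|_{(-\tau,0)}$, remains bounded.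
   Context: The Hilbert space $X$ is over the complex numbers. $(-\mathcal{A})^\alpha$ is defined spectrally: $(-\mathcal{A})^\alpha u=\sum_j(-\tilde\lambda_j)^\alpha\langle u,\phi_j\rangle\phi_j$, where $-\tilde\lambda_j>0$. $(X,D(\mathcal{A}))_{1/2,2}$ denotes the real interpolation space, $D(\mathcal{A})$ carrying the graph norm. *)

(* Defs.v *)
From HB Require Import structures.
From mathcomp Require Import all_boot all_order all_algebra.
From mathcomp Require Import complex.
From mathcomp Require Import all_classical all_reals all_analysis.

Set Implicit Arguments.
Unset Strict Implicit.
Unset Printing Implicit Defensive.
Import Order.TTheory GRing.Theory Num.Theory.
Import numFieldNormedType.Exports.

Local Open Scope classical_set_scope.
Local Open Scope ring_scope.
Local Open Scope complex_scope.

(* The norm of a normed module over R[i] takes its values in R[i]; they are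
   nonnegative, hence real, and [rnorm] is the same norm with values in R. *)
Definition rnorm (R : realType) (X : normedModType R[i]) (x : X) : R :=
  complex.Re `|x|.

(* A complex Hilbert space is a complete normed space whose norm is induced by
   an inner product.  A form of type {dot X for conjC} is positive definite,
   linear in its first argument and conjugate-linear in the second one. *)
Definition induces_norm (R : realType) (X : normedModType R[i])
    (dot : {dot X for @Num.conj R[i]}) : Prop :=
  forall x : X, `|x| ^+ 2 = dot x x.

(* Only the restriction of [op] to the subspace [dom] is meaningful. *)
Record operator (K : pzRingType) (X : lmodType K) := Operator {
  dom : set X;
  op :> X -> X;
  dom0 : dom 0;
  dom_lin : forall (a : K) (x y : X), dom x -> dom y -> dom (a *: x + y);
  op_lin : forall (a : K) (x y : X), dom x -> dom y ->
    op (a *: x + y) = a *: op x + op y }.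

Section Hilbert.
Variables (R : realType) (X : normedModType R[i]).
Variable dot : {dot X for @Num.conj R[i]}.

(* The pair (y, z) belongs to the graph of the adjoint of A. *)
Definition adjoint_graph (A : operator X) (y z : X) : Prop :=
  forall x, dom A x -> dot (A x) y = dot x z.

Definition self_adjoint (A : operator X) : Prop :=
  dense (dom A) /\
  forall y z, adjoint_graph A y z <-> dom A y /\ z = A y.

(* The order of R[i] makes this say that <-Ax, x> is real and positive. *)
Definition negative_operator (A : operator X) : Prop :=
  forall x, dom A x -> x != 0 -> 0 < dot (- A x) x.

Definition complete_orthonormal (phi : nat -> X) : Prop :=
  (forall i j, dot (phi i) (phi j) = (i == j)%:R) /\
  (forall x, (forall j, dot x (phi j) = 0) -> x = 0).

(* Spectral power (-A)^alpha for eigenvalues [lambda] and orthonormal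
   eigenfunctions [phi] of A; its domain consists of the vectors for which the
   defining series converges in X. *)
Definition frac_pow_series (lambda : nat -> R) (phi : nat -> X) (alpha : R)
    (x : X) : nat -> X :=
  series (fun j => ((- lambda j) `^ alpha)%:C *: (dot x (phi j) *: phi j)).

Definition frac_pow_dom (lambda : nat -> R) (phi : nat -> X) (alpha : R) :
    set X :=
  [set x | cvgn (frac_pow_series lambda phi alpha x)].

Definition frac_pow (lambda : nat -> R) (phi : nat -> X) (alpha : R)
    (x : X) : X :=
  limn (frac_pow_series lambda phi alpha x).

End Hilbert.

Section FunctionSpaces.
Variables (R : realType) (X : normedModType R[i]).

Definition graph_norm (A : operator X) (x : X) : R := rnorm x + rnorm (A x).

(* Below, a normed space Y continuously embedded in X is given by its carrier
   [D : set X] and its norm [N]. *)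

Definition K_functional (D : set X) (N : X -> R) (s : R) (x : X) : R :=
  inf [set rnorm (x - b) + s * N b | b in D].

(* The real interpolation space (X, Y)_{theta, p}, 1 <= p < oo. *)
Definition real_interpolation (D : set X) (N : X -> R) (theta p : R) : set X :=
  [set x | (\int[lebesgue_measure]_(s in `]0%R, +oo[)
     (((s `^ (- theta) * K_functional D N s x) `^ p / s)%R)%:E < +oo)%E].

Definition simple (D : set X) (s : R -> X) : Prop :=
  [/\ forall t, D (s t), finite_set (range s) &
      forall y, measurable (s @^-1` [set y])].

(* Bochner (strong) measurability on I of a function with values in Y. *)
Definition strongly_measurable (I : set R) (D : set X) (N : X -> R)
    (f : R -> X) : Prop :=
  exists s : nat -> R -> X, (forall n, simple D (s n)) /\
    {ae lebesgue_measure, forall t, I t ->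
       D (f t) /\ (N (s n t - f t) @[n --> \oo] --> (0 : R))}.

(* The restriction of f to I belongs to the Bochner space L^2(I, Y). *)
Definition bochner_L2 (I : set R) (D : set X) (N : X -> R) (f : R -> X) :
    Prop :=
  strongly_measurable I D N f /\
  (\int[lebesgue_measure]_(t in I) ((N (f t) ^+ 2)%R)%:E < +oo)%E.

(* u has derivative v at t, with respect to a real variable. *)
Definition has_derivative (u : R -> X) (t : R) (v : X) : Prop :=
  (h^-1)%:C *: (u (t + h) - u t) @[h --> (0 : R)^'] --> v.

(* The norm of (x, psi) in X * L^2((-tau, 0), X). *)
Definition data_norm (tau : R) (x : X) (psi : R -> X) : \bar R :=
  (((rnorm x ^+ 2)%R%:E + \int[lebesgue_measure]_(t in `](- tau)%R, 0%R[)
      ((rnorm (psi t) ^+ 2)%R)%:E) `^ 2^-1)%E.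

End FunctionSpaces.

Section DelayProblem.
Variables (R : realType) (X : normedModType R[i]).
Variable dot : {dot X for @Num.conj R[i]}.
Variables (A : operator X) (lambda : nat -> R) (phi : nat -> X).
Variables (tau eps alpha : R).

(* Right-hand side A u(t - tau) - eps (-A)^alpha u(t). *)
Definition delay_rhs (u : R -> X) (t : R) : X :=
  A (u (t - tau)) - eps%:C *: frac_pow dot lambda phi alpha (u t).

(* u, whose values outside (-tau, oo) are irrelevant, solves the delay problem
   with data (u0, psi).  The equation is required pointwise at every t > 0, with
   a strong derivative, and u lies in the maximal regularity class
   W^{1,2}((0,T), X) `&` L^2((0,T), D(A)) for every T; given the pointwise
   derivative and the continuity at 0, its W^{1,2} part amounts to the
   square-integrability of the right-hand side. *)
Record delay_solution (u0 : X) (psi : R -> X) (u : R -> X) : Prop := {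
  initial_value :
    real_interpolation (dom A) (graph_norm A) 2^-1 2 u0;
  initial_history :
    bochner_L2 `](- tau), 0[ (dom A) (graph_norm A) psi;
  solution_at0 : u 0 = u0;
  solution_history : forall t : R, - tau < t < 0 -> u t = psi t;
  solution_continuous : {within `[0, +oo[, continuous u};
  solution_equation : forall t : R, 0 < t ->
    [/\ dom A (u (t - tau)),
        frac_pow_dom dot lambda phi alpha (u t) &
        has_derivative u t (delay_rhs u t)];
  solution_L2dom : forall T : R, 0 < T ->
    bochner_L2 `]0, T[ (dom A) (graph_norm A) u;
  solution_L2deriv : forall T : R, 0 < T ->
    bochner_L2 `]0, T[ setT (@rnorm R X) (delay_rhs u) }.

End DelayProblem.

(* Main.v *)
Require Import Defs.
From HB Require Import structures.
From mathcomp Require Import all_boot all_order all_algebra.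
From mathcomp Require Import complex.
From mathcomp Require Import all_classical all_reals all_analysis.
From mathcomp Require Import measurable_realfun ring lra.

Set Implicit Arguments.
Unset Strict Implicit.
Unset Printing Implicit Defensive.
Import Order.TTheory GRing.Theory Num.Theory.
Import numFieldNormedType.Exports.
Import ComplexField.Normc.

Local Open Scope classical_set_scope.
Local Open Scope ring_scope.
Local Open Scope complex_scope.

(* If mu = - lambda_n, then e^{zt} phi_n solves the equation as soon as
   z + eps mu^alpha = - mu e^{- z tau}.  Since alpha < 1, the term eps mu^alpha
   is negligible before mu, and this characteristic equation has a root whose
   real part tends to +oo with mu.  Such a solution has norm e^{t Re z}, which
   is at most 1 for t <= 0 and blows up with mu at every t > 0. *)

(** * Roots of the characteristic equation for large mu *)

(** Raising the second lower bound on m to the power 1 - alpha > 0 gives 1/d <= m^(1 - alpha) = m /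
    m^alpha. *)
Lemma powR_le_eps (R : realType) (alpha d m : R) : alpha < 1 -> 0 < d ->
  1 <= m -> d^-1 `^ (1 - alpha)^-1 <= m -> m `^ alpha <= d * m.
Proof.
move=> a1 d0 m1 dm; have m0 : 0 < m by lra.
have b0 : 0 < 1 - alpha by lra.
have : d^-1 <= m `^ (1 - alpha).
  have := ge0_ler_powR (ltW b0) _ _ dm.
  rewrite -powRrM mulVf ?gt_eqF// powRr1 ?invr_ge0 ?(ltW d0)//.
  by apply; rewrite nnegrE ?powR_ge0// ltW.
rewrite powRB ?gt_eqF ?implybT//.
rewrite powRr1 ?(ltW m0)// ler_pdivlMr ?powR_gt0//.
by rewrite mulrC ler_pdivrMr// mulrC.
Qed.

Lemma near_powR_affine_lt (R : realType) (mu : nat -> R) (alpha eps a C : R) :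
  alpha < 1 -> 0 < eps -> 0 < C -> mu j @[j --> \oo] --> +oo ->
  \forall j \near \oo, (a + eps * mu j `^ alpha) * C < mu j.
Proof.
move=> a1 e0 C0 /cvgryPge mu_oo.
(* This d makes eps C mu^alpha at most mu / 2. The constant a C is strictly below the other half as
   soon as 2 a C + 1 <= mu. *)
pose d := (2 * eps * C)^-1.
have d0 : 0 < d by rewrite invr_gt0 !mulr_gt0.
near=> j.
have H : mu j `^ alpha <= d * mu j.
  by apply: powR_le_eps => //; near: j; exact: mu_oo.
have H2 : 2 * a * C + 1 <= mu j by near: j; exact: mu_oo.
have H3 : eps * C * mu j `^ alpha <= mu j / 2.
  have -> : mu j / 2 = eps * C * (d * mu j).
    by rewrite /d; field; rewrite !gt_eqF.
  by rewrite ler_pM2l// mulr_gt0.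
by rewrite mulrDl; lra.
Unshelve. all: by end_near. Qed.

(* With z = x + i y, 0 < y tau < pi and s = pi - y tau, dividing the two real
   equations gives x + b = y cot s; what remains is one real equation in s,
   solved by the intermediate value theorem on ]0, pi/2].  At the solution
   mu e^{- x tau} = y / sin s <= y + x + b, which forces x to be large. *)
Lemma delay_characteristic_root (R : realType) (tau b mu : R) :
  0 < tau -> 0 <= b -> pi / tau + b < mu ->
  exists x y : R,
    [/\ x + b = - mu * expR (- (x * tau)) * cos (y * tau),
        y = mu * expR (- (x * tau)) * sin (y * tau) &
        forall M, 0 <= M -> (pi / tau + M + b) * expR (M * tau) < mu -> M < x].
Proof.
move=> t0 b0 mub; have p0 := @pi_gt0 R; have p2 := @pi_ge2 R.
have pt0 : 0 < pi / tau by rewrite divr_gt0.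
have mu0 : 0 < mu by lra.
(* [X s] is the x forced by x + b = y cot s with y = (pi - s) / tau. Then mu e^{- x tau} = y / sin s
   becomes [F s] = mu, the equation left to solve. *)
pose X s := (pi - s) / tau * (cos s / sin s) - b.
pose F s := (pi - s) / tau / sin s * expR (X s * tau).
have [s1 [s10 s1p Fs1]] : exists s1, [/\ 0 < s1, s1 < pi / 2 & mu <= F s1].
  (* As pi - s >= 1, the first bound on sin s gives y / sin s >= mu. As also cos s > 1/2, the second
     gives y cot s >= b + 1, so [X s] >= 0 and the exponential factor of [F s] is at least 1. *)
  pose e := Num.min (tau * mu)^-1 (2 * tau * (b + 1))^-1.
  have e0 : 0 < e by rewrite lt_min !invr_gt0 !mulr_gt0//; lra.
  have : \forall s \near (0 : R)^'+, [/\ 0 < s, s < pi / 2,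
      2^-1 < cos s & sin s < e].
    near=> s; split.
    - by near: s; exact: nbhs_right_gt.
    - by near: s; apply: nbhs_right_lt; lra.
    - near: s; apply: (cvgr_gt (cos (0:R))); last by rewrite cos0; lra.
      by apply: cvg_at_right_filter; exact: continuous_cos.
    - near: s; apply: (cvgr_lt (sin (0:R))); last by rewrite sin0.
      by apply: cvg_at_right_filter; exact: continuous_sin.
  move=> /filter_ex; case=> s [s0 sp cs ss].
  exists s; split => //.
  have sin0 : 0 < sin s by apply: sin_gt0_pihalf; rewrite s0.
  move: ss; rewrite lt_min => /andP[ss1 ss2].
  have ps : 1 <= pi - s by lra.
  have h1 : tau * mu <= (sin s)^-1.
    by rewrite -[leLHS]invrK lef_pV2 ?posrE ?invr_gt0 ?mulr_gt0// ltW.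
  have h2 : 2 * tau * (b + 1) <= (sin s)^-1.
    rewrite -[leLHS]invrK lef_pV2 ?posrE ?invr_gt0 ?mulr_gt0//; last lra.
    by rewrite ltW.
  have h3 : mu <= (pi - s) / tau / sin s.
    rewrite -[_ / tau / _]mulrA [_ / sin s]mulrC mulrA ler_pdivlMr//.
    rewrite mulrC (le_trans h1)// ler_peMl// invr_ge0 ltW//.
  have h4 : 0 <= X s.
    rewrite /X subr_ge0 mulrA.
    have -> : (pi - s) / tau * cos s / sin s = (pi - s) * cos s * (sin s)^-1 / tau.
      by ring.
    rewrite ler_pdivlMr//.
    have : 1 * 2^-1 * (2 * tau * (b + 1)) <= (pi - s) * cos s / sin s.
      apply: ler_pM => //; last apply: ler_pM => //; try lra.
      by rewrite !mulr_ge0//; lra.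
    by move: t0 b0; nra.
  apply: (le_trans h3); rewrite ler_peMr//.
    by rewrite !divr_ge0// ?ltW//; lra.
  by rewrite -expR0 ler_expR mulr_ge0// ltW.
(* At pi / 2 the cotangent vanishes, so x = - b and [F] is at most pi / (2 tau) < mu. *)
have Fpi : F (pi / 2) <= mu.
  rewrite /F /X cos_pihalf sin_pihalf mul0r mulr0 add0r divr1.
  have : expR (- b * tau) <= 1 by rewrite expR_le1 mulNr oppr_le0 mulr_ge0// ltW.
  have : 0 < expR (- b * tau) by exact: expR_gt0.
  have -> : pi - pi / 2 = pi / 2 :> R by lra.
  have -> : pi / 2 / tau = pi / tau / 2 by ring.
  by nra.
have sinp s : s1 <= s <= pi / 2 -> 0 < sin s.
  by move=> /andP[? ?]; apply: sin_gt0_pi; apply/andP; split; lra.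
have cF : {within `[s1, pi / 2], continuous F}.
  apply: continuous_in_subspaceT => s; rewrite inE/= in_itv/= => /sinp s0.
  have cs : (fun s => (pi - s) / tau) @ s --> (pi - s) / tau.
    by apply: cvgMl; apply: cvgB; [exact: cvg_cst|exact: cvg_id].
  have ci : (fun s => (sin s)^-1) @ s --> (sin s)^-1.
    by apply: cvgV; [rewrite gt_eqF|exact: continuous_sin].
  apply: cvgM; first exact: cvgM.
  apply: continuous_comp; last exact: continuous_expR.
  apply: cvgMl; apply: cvgB; last exact: cvg_cst.
  apply: cvgM => //; apply: cvgM => //; exact: continuous_cos.
have [|s] := IVT (ltW s1p) cF (_ : Num.min _ _ <= mu <= Num.max _ _).
  by rewrite ge_min le_max Fpi Fs1 orbT.
rewrite in_itv/= => /[dup] /andP[ss sp] /sinp s0 Fs.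
have cs0 : 0 <= cos s by apply: cos_ge0_pihalf; apply/andP; split; lra.
pose y := (pi - s) / tau.
have y0 : 0 < y by rewrite divr_gt0//; lra.
have yt : y * tau = pi - s by rewrite /y divfK// gt_eqF.
have cy : cos (y * tau) = - cos s by rewrite yt cosB cospi sinpi; ring.
have sy : sin (y * tau) = sin s by rewrite yt sinB cospi sinpi; ring.
have Es : mu * expR (- (X s * tau)) = y / sin s.
  by rewrite expRN -Fs /F mulfK// gt_eqF// expR_gt0.
exists (X s), y; split.
- rewrite cy mulNr Es mulrNN /X -/y; ring.
- by rewrite Es sy divfK// gt_eqF.
(* If x <= M, both factors of mu = [F s] are bounded in terms of M, which contradicts the size of
   mu. *)
move=> M M0 HM; rewrite ltNge; apply/negP => XM.
suff : mu <= (pi / tau + M + b) * expR (M * tau) by lra.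
rewrite -Fs /F; apply: ler_pM.
- by rewrite divr_ge0// ltW.
- exact: expR_ge0.
- rewrite -/y.
  (* Sine and cosine are nonnegative here and their squares add up to 1. Multiplying by y / sin s
     turns this into y / sin s <= y + y cot s = y + x + b. *)
  have h : 1 <= sin s + cos s.
    by have := cos2Dsin2 s; nra.
  have : y / sin s <= y + (X s + b).
    have -> : y + (X s + b) = y / sin s * (sin s + cos s).
      by rewrite /X -/y; field; rewrite gt_eqF.
    by rewrite ler_peMr// divr_ge0// ltW.
  have : y <= pi / tau by rewrite ler_pM2r ?invr_gt0//; lra.
  by lra.
- by rewrite ler_expR ler_pM2r.
Unshelve. all: by end_near. Qed.

(** * The real-valued norm and the K-functional of an operator domain *)

Lemma normc_leD (R : realType) (a b : R) : normc (a +i* b) <= `|a| + `|b|.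
Proof.
rewrite /= -(sqr_sqrtr (normr_ge0 a)) -(sqr_sqrtr (normr_ge0 b)).
rewrite !sqr_sqrtr ?normr_ge0//.
rewrite -[leRHS]ger0_norm ?addr_ge0// -sqrtr_sqr ler_wsqrtr//.
rewrite sqrrD !real_normK ?num_real//.
by rewrite lerD2r lerDl mulrn_wge0// mulr_ge0.
Qed.

Section RealNorm.
Variables (R : realType) (X : normedModType R[i]).
Implicit Types (x y : X) (c : R[i]).

Lemma rnormE x : (rnorm x)%:C = `|x|.
Proof. exact: RRe_real (ger0_real (normr_ge0 x)). Qed.

Lemma rnorm_ge0 x : 0 <= rnorm x.
Proof. by rewrite -ler0c rnormE. Qed.

Lemma rnorm0 : rnorm (0 : X) = 0.
Proof. by apply: complexI; rewrite rnormE normr0. Qed.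

Lemma rnormZ c x : rnorm (c *: x) = normc c * rnorm x.
Proof. by apply: complexI; rewrite rmorphM /= !rnormE normrZ. Qed.

Lemma cvg_rnorm (T : Type) (F : set_system T) (FF : Filter F) (f : T -> X)
    (l : X) : rnorm (f x - l) @[x --> F] --> (0 : R) -> f x @[x --> F] --> l.
Proof.
move=> h; apply/cvgrPdist_lt => e.
(* The radius e is an element of R[i]; being positive, it has zero imaginary part and its real part
   serves as a real radius. *)
rewrite ltcE /= => /andP[/eqP e0 e1].
apply: filterS (@cvgr_lt _ _ _ _ _ _ h (complex.Re e) e1) => t.
rewrite distrC -rnormE -ltcR => /lt_le_trans; apply.
by rewrite lecE /= e0 eqxx lexx.
Qed.

Section Operator.
Variable A : operator X.

Lemma op0 : A 0 = 0.
Proof.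
have := op_lin 1 (dom0 A) (dom0 A).
rewrite !scale1r add0r => /eqP.
by rewrite -subr_eq0 opprD addNKr oppr_eq0 => /eqP.
Qed.

Lemma domZ c x : dom A x -> dom A (c *: x).
Proof. by move=> Ax; rewrite -[_ *: _]addr0; apply: dom_lin => //; exact: dom0. Qed.

Lemma opZ c x : dom A x -> A (c *: x) = c *: A x.
Proof.
by move=> Ax; have := op_lin c Ax (dom0 A); rewrite op0 !addr0.
Qed.

Lemma graph_norm_ge0 x : 0 <= graph_norm A x.
Proof. by rewrite addr_ge0 ?rnorm_ge0. Qed.

Lemma graph_normZ c x : dom A x ->
  graph_norm A (c *: x) = normc c * graph_norm A x.
Proof. by move=> Ax; rewrite /graph_norm opZ// !rnormZ mulrDr. Qed.

Local Notation K := (K_functional (dom A) (graph_norm A)).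

Lemma K_functional_le s x b : 0 <= s -> dom A b ->
  K s x <= rnorm (x - b) + s * graph_norm A b.
Proof.
move=> s0 Ab; apply: ge_inf; last by exists b.
by exists 0 => _ [c _ <-]; rewrite addr_ge0 ?mulr_ge0 ?rnorm_ge0 ?graph_norm_ge0.
Qed.

Lemma le_K_functional s x r : (forall b, dom A b ->
  r <= rnorm (x - b) + s * graph_norm A b) -> r <= K s x.
Proof.
move=> h; apply: lb_le_inf; last by move=> _ [b Ab <-]; exact: h.
by exists (rnorm (x - 0) + s * graph_norm A 0), 0 => //; exact: dom0.
Qed.

Lemma K_functional_ge0 s x : 0 <= s -> 0 <= K s x.
Proof.
move=> s0; apply: le_K_functional => b _.
by rewrite addr_ge0 ?mulr_ge0 ?rnorm_ge0 ?graph_norm_ge0.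
Qed.

Lemma K_functional_homo s s' x : 0 <= s -> s <= s' -> K s x <= K s' x.
Proof.
move=> s0 ss'; apply: le_K_functional => b Ab.
apply: (le_trans (K_functional_le x s0 Ab)).
by rewrite lerD2l ler_wpM2r ?graph_norm_ge0.
Qed.

(** Monotone functions are measurable. Monotonicity in s is available only for s >= 0, so s is
    replaced by max(s, 0) to get a function monotone on the whole line that agrees with K on the
    interval. *)
Lemma measurable_K_functional x : measurable_fun `](0 : R), +oo[ (K ^~ x).
Proof.
apply: (eq_measurable_fun (fun s : R => K (Num.max s 0) x)).
  move=> s; rewrite inE/= in_itv/= andbT => s0.
  by congr (K _ x); apply/max_idPl; exact: ltW.
apply: nondecreasing_measurable => // s s' ss'.
by apply: K_functional_homo; [rewrite le_max lexx orbT|exact: le_max2].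
Qed.

(* K(s, x) <= min (|x|, s |x|_A), so that the integrand K(s, x)^2 / s^2 is at
   most (|x|^2 + |x|_A^2) / (1 + s^2). *)
Lemma dom_real_interpolation x : dom A x ->
  real_interpolation (dom A) (graph_norm A) 2^-1 2 x.
Proof.
move=> Ax; rewrite /real_interpolation /=.
pose C := rnorm x ^+ 2 + graph_norm A x ^+ 2.
have C0 : 0 <= C by rewrite addr_ge0 ?sqr_ge0.
have measV : measurable_fun `](0 : R), +oo[ (fun s : R => s^-1).
  apply: (eq_measurable_fun (fun s => s `^ (-1))).
    by move=> s; rewrite inE/= in_itv/= andbT => s0; rewrite powR_inv1// ltW.
  exact: measurable_funTS (measurable_powR _).
have measO : measurable_fun setT (fun s : R => (oneDsqr s)^-1).
  by apply: continuous_measurable_fun; exact: continuous_oneDsqrV.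
(* The majorant is integrated over the closed half-line, where the integral of 1 / (1 + s^2) is
   known; the endpoint 0 is added to the domain in the next step. *)
apply: (@le_lt_trans _ _ (\int[lebesgue_measure]_(s in `[0%R, +oo[)
    (C%:E * ((oneDsqr s)^-1)%:E))%E); last first.
  rewrite ge0_integralZl//=.
  - by rewrite integral0y_oneDsqr -EFinM ltry.
  - by apply/measurable_EFinP; exact: measurable_funTS.
apply: (@le_trans _ _ (\int[lebesgue_measure]_(s in `]0%R, +oo[)
    (C%:E * ((oneDsqr s)^-1)%:E))%E); last first.
  apply: ge0_subset_integral => //=.
  - by apply: measurable_funeM; apply/measurable_EFinP; exact: measurable_funTS.
  - by move=> s _; rewrite mule_ge0 ?lee_fin// invr_ge0.
  - by move=> s /=; rewrite !in_itv/= !andbT => /ltW.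
apply: ge0_le_integral => //=.
- by move=> s; rewrite in_itv/= andbT => s0; rewrite lee_fin divr_ge0 ?powR_ge0 ?ltW.
- apply/measurable_EFinP; apply: measurable_funM => //.
  apply: (@measurableT_comp _ _ _ _ _ _ (fun s : R => s `^ 2)).
    exact: measurable_powR.
  apply: measurable_funM; last exact: measurable_K_functional.
  exact: measurable_funTS (measurable_powR _).
- by apply: measurable_funeM; apply/measurable_EFinP; exact: measurable_funTS.
move=> s; rewrite in_itv/= andbT => s0.
rewrite -EFinM lee_fin.
have K0 := K_functional_ge0 x (ltW s0).
(* The two bounds on K come from the competitors b = 0 and b = x in the infimum. *)
have Kx : K s x <= rnorm x.
  apply: (le_trans (K_functional_le x (ltW s0) (dom0 A))).
  by rewrite subr0 /graph_norm op0 rnorm0 addr0 mulr0 addr0.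
have Ks : K s x <= s * graph_norm A x.
  apply: (le_trans (K_functional_le x (ltW s0) Ax)).
  by rewrite subrr rnorm0 add0r.
rewrite powR_mulrn ?mulr_ge0 ?powR_ge0// exprMn.
rewrite -[(s `^ _) ^+ 2]powR_mulrn ?powR_ge0// -powRrM mulNr mulVf//.
rewrite powR_inv1 ?(ltW s0)//.
rewrite ler_pdivlMr ?oneDsqr_gt0// /oneDsqr /C.
have -> : s^-1 * K s x ^+ 2 / s * (1 + s ^+ 2) = (K s x / s) ^+ 2 + K s x ^+ 2.
  by field; rewrite gt_eqF.
rewrite addrC; apply: lerD; first by rewrite lerXn2r ?nnegrE ?rnorm_ge0.
rewrite lerXn2r ?nnegrE ?graph_norm_ge0 ?divr_ge0 ?(ltW s0)//.
by rewrite ler_pdivrMr// mulrC.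
Qed.

End Operator.
End RealNorm.

(** * Curves c(t) v along a fixed vector: continuity, derivative, Bochner integrability *)

Lemma complexB (R : rcfType) (p q r s : R) :
  (p +i* q) - (r +i* s) = (p - r) +i* (q - s).
Proof. by []. Qed.

(** The common majorant of the squeeze arguments below: f and g are the real and imaginary parts of
    the scalar, and k is the norm of the fixed vector. *)
Lemma cvg_dist_sum (R : realType) (T : Type) (F : set_system T)
    (FF : Filter F) (f g : T -> R) (l m k : R) :
  f x @[x --> F] --> l -> g x @[x --> F] --> m ->
  (`|f x - l| + `|g x - m|) * k @[x --> F] --> (0 : R).
Proof.
move=> fl gm.
have fl0 : `|f x - l| @[x --> F] --> (0 : R) by apply/norm_cvg0P/subr_cvg0.
have gm0 : `|g x - m| @[x --> F] --> (0 : R) by apply/norm_cvg0P/subr_cvg0.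
by have := cvgM (cvgD fl0 gm0) (cvg_cst k); rewrite addr0 mul0r; apply.
Qed.

Section Line.
Variables (R : realType) (X : normedModType R[i]) (v : X).
Variables a b : R -> R.

Lemma scaler_complex_continuous : continuous a -> continuous b ->
  continuous (fun t => (a t +i* b t) *: v).
Proof.
move=> ca cb t; apply: cvg_rnorm.
apply: (@squeeze_cvgr _ _ _ _ (fun=> 0)
  (fun s => (`|a s - a t| + `|b s - b t|) * rnorm v)).
- near=> s; rewrite rnorm_ge0/= -scalerBl rnormZ complexB.
  by rewrite ler_wpM2r ?rnorm_ge0// normc_leD.
- exact: cvg_cst.
- by apply: cvg_dist_sum; [exact: ca|exact: cb].
Unshelve. all: by end_near. Qed.

Lemma scaler_complex_derivative (t a' b' : R) :
  is_derive t 1 a a' -> is_derive t 1 b b' ->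
  has_derivative (fun s => (a s +i* b s) *: v) t ((a' +i* b') *: v).
Proof.
move=> da db; rewrite /has_derivative.
(* The derivative in direction 1 is restated as the limit of the usual difference quotient. *)
have quot (c : R -> R) c' : is_derive t 1 c c' ->
    h^-1 * (c (t + h) - c t) @[h --> 0^'] --> c'.
  move=> [dc <-]; rewrite (_ : (fun h : R => _) =
      (fun h => h^-1 *: ((c \o shift t) (h *: 1) - c t))).
    exact: dc.
  by apply/funext => h; rewrite /= [h *: 1]mulr1 [h + t]addrC.
apply: cvg_rnorm.
apply: (@squeeze_cvgr _ _ _ _ (fun=> 0)
  (fun h => (`|h^-1 * (a (t + h) - a t) - a'| +
             `|h^-1 * (b (t + h) - b t) - b'|) * rnorm v)).
- near=> h; rewrite rnorm_ge0/= -scalerBl scalerA -scalerBl rnormZ complexB.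
  by rewrite !mul0r subr0 addr0 ler_wpM2r ?rnorm_ge0// normc_leD.
- exact: cvg_cst.
- by apply: cvg_dist_sum; exact: quot.
Unshelve. all: by end_near. Qed.

Import HBSimple.

(** Simple approximations of a and b, multiplied by v, approximate the curve, and a continuous
    function is bounded on the compact interval [p, q]. The pair [D], [N] is left general to cover
    both D(A) with its graph norm and X itself. *)
Lemma bochner_L2_scaler (p q : R) (D : set X) (N : X -> R) :
  v != 0 -> (forall c : R[i], D (c *: v)) ->
  (forall c : R[i], N (c *: v) = normc c * N v) ->
  0 <= N v -> continuous a -> continuous b ->
  bochner_L2 `]p, q[ D N (fun t => (a t +i* b t) *: v).
Proof.
move=> v0 Dv Nv Nv0 ca cb; split.
  have mE (c : R -> R) : continuous c -> measurable_fun setT (EFin \o c).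
    by move=> cc; apply/measurable_EFinP; exact: continuous_measurable_fun.
  have [g ga] := approximation_sfun measurableT (mE _ ca).
  have [h hb] := approximation_sfun measurableT (mE _ cb).
  exists (fun n t => (g n t +i* h n t) *: v); split.
    move=> n; split=> [t|| y].
    - exact: Dv.
    - apply: (finite_image11 (fun r s => (r +i* s) *: v)); exact: fimfunP.
    (* Since v is nonzero, the scalar is determined by the vector: a nonempty fibre is the
       intersection of a fibre of [g n] with one of [h n]. *)
    - have [[t0 <-]|Ny] := pselect (exists t0, (g n t0 +i* h n t0) *: v = y).
        rewrite (_ : _ @^-1` _ =
            (g n @^-1` [set g n t0]) `&` (h n @^-1` [set h n t0])).
          exact: measurableI.
        apply/seteqP; split=> t /=.
          move=> /eqP; rewrite -subr_eq0 -scalerBl scaler_eq0 (negbTE v0) orbF.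
          by rewrite subr_eq0 => /eqP[-> ->].
        by move=> [-> ->].
      rewrite (_ : _ @^-1` _ = set0)//.
      by apply/seteqP; split=> t //= ty; apply: Ny; exists t.
  apply: aeW => t _; split; first exact: Dv.
  apply: (@squeeze_cvgr _ _ _ _ (fun=> 0)
    (fun n => (`|g n t - a t| + `|h n t - b t|) * N v)).
  - near=> n; rewrite -scalerBl Nv complexB; apply/andP; split.
      by rewrite mulr_ge0// sqrtr_ge0.
    by rewrite ler_wpM2r// normc_leD.
  - exact: cvg_cst.
  - apply: cvg_dist_sum.
      by have /fine_cvgP[_] := ga t Logic.I.
    by have /fine_cvgP[_] := hb t Logic.I.
have [qp|pq] := ltP q p.
  by rewrite set_itv_ge ?integral_set0 ?ltry// bnd_simp -leNgt ltW.
pose f t := a t ^+ 2 + b t ^+ 2.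
have cf : continuous f.
  by move=> t; apply: cvgD; apply: cvgM; (exact: ca || exact: cb).
have [m _ fm] := EVT_max pq (continuous_subspaceT cf).
have Nf t : N ((a t +i* b t) *: v) ^+ 2 = f t * N v ^+ 2.
  by rewrite Nv exprMn sqr_sqrtr// addr_ge0 ?sqr_ge0.
apply: (@le_lt_trans _ _
    (\int[lebesgue_measure]_(t in `]p, q[) (cst (f m * N v ^+ 2)%:E t))%E).
  apply: ge0_le_integral => //=.
  - by move=> t _; rewrite lee_fin sqr_ge0.
  - apply/measurable_EFinP.
    apply: (eq_measurable_fun (fun t => f t * N v ^+ 2)) => [t _|].
      by rewrite Nf.
    apply: measurable_funM => //; apply: measurable_funTS.
    exact: continuous_measurable_fun.
  - move=> t tpq; rewrite lee_fin Nf ler_wpM2r ?sqr_ge0// fm//.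
    exact: subset_itv_oo_cc.
rewrite integral_cst//= lebesgue_measure_itv /=.
by case: ifP => _; rewrite ?mule0 ?ltry// -EFinB -EFinM ltry.
Unshelve. all: by end_near. Qed.

End Line.

(** * Real and imaginary parts of e^{(x + iy) t} *)

Definition Re_exp (R : realType) (x y t : R) : R := expR (x * t) * cos (y * t).
Definition Im_exp (R : realType) (x y t : R) : R := expR (x * t) * sin (y * t).

Section ComplexExponential.
Variables (R : realType) (x y : R).

Lemma is_derive_mul_id (z t : R) : is_derive t 1 (fun s : R => z * s) z.
Proof. exact: (is_derive_eq (is_deriveZ z (is_derive_id t 1)) (mulr1 z)). Qed.

Lemma is_derive_Re_exp (t : R) :
  is_derive t 1 (Re_exp x y) (x * Re_exp x y t - y * Im_exp x y t).
Proof.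
have dE := is_derive1_comp (is_derive_expR (x * t)) (is_derive_mul_id x t).
have dC := is_derive1_comp (is_derive_cos (y * t)) (is_derive_mul_id y t).
apply: (is_derive_eq (is_deriveM dE dC)).
by rewrite /Re_exp /Im_exp /= /GRing.scale /=; ring.
Qed.

Lemma is_derive_Im_exp (t : R) :
  is_derive t 1 (Im_exp x y) (y * Re_exp x y t + x * Im_exp x y t).
Proof.
have dE := is_derive1_comp (is_derive_expR (x * t)) (is_derive_mul_id x t).
have dS := is_derive1_comp (is_derive_sin (y * t)) (is_derive_mul_id y t).
apply: (is_derive_eq (is_deriveM dE dS)).
by rewrite /Re_exp /Im_exp /= /GRing.scale /=; ring.
Qed.

Lemma continuous_Re_exp : continuous (Re_exp x y).
Proof.
move=> t; apply/differentiable_continuous/derivable1_diffP.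
by have [] := is_derive_Re_exp t.
Qed.

Lemma continuous_Im_exp : continuous (Im_exp x y).
Proof.
move=> t; apply/differentiable_continuous/derivable1_diffP.
by have [] := is_derive_Im_exp t.
Qed.

End ComplexExponential.

(** * Exponential modes e^{zt} phi_n as solutions of the delay problem *)

Section ExpMode.
Variables (R : realType) (X : normedModType R[i]).
Variable dot : {dot X for @Num.conj R[i]}.
Hypothesis hdot : induces_norm dot.
Variable A : operator X.
Variables (phi : nat -> X) (lambda : nat -> R).
Hypothesis hphi : complete_orthonormal dot phi.
Hypothesis heig :
  forall j, dom A (phi j) /\ A (phi j) = (lambda j)%:C *: phi j.
Variables (tau eps alpha : R).

Lemma rnorm_orthonormal n : rnorm (phi n) = 1.
Proof.
suff : `|phi n| == 1 :> R[i] by move/eqP; rewrite /rnorm => ->.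
by rewrite -sqrp_eq1// hdot hphi.1 eqxx.
Qed.

(** The m-th partial sum runs over indices below m, and orthonormality kills every term but the
    n-th. The series is thus constant from n + 1 on, which settles both its convergence and its
    limit. *)
Lemma frac_pow_series_eigen n (c : R[i]) m : (n < m)%N ->
  frac_pow_series dot lambda phi alpha (c *: phi n) m =
  ((- lambda n) `^ alpha)%:C *: (c *: phi n).
Proof.
move=> nm; rewrite /frac_pow_series /series /= big_mkord.
rewrite (bigD1 (Ordinal nm))//= big1 ?addr0.
  by rewrite linearZl_LR /= hphi.1 eqxx mulr1.
move=> i; rewrite -val_eqE /= => ni.
by rewrite linearZl_LR /= hphi.1 eq_sym (negbTE ni) mulr0 scale0r scaler0.
Qed.

Lemma frac_pow_dom_eigen n (c : R[i]) :
  frac_pow_dom dot lambda phi alpha (c *: phi n).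
Proof.
apply: (is_cvg_near_cst (((- lambda n) `^ alpha)%:C *: (c *: phi n))).
by exists n.+1 => // m /= nm; exact: frac_pow_series_eigen.
Qed.

Lemma frac_pow_eigen n (c : R[i]) :
  frac_pow dot lambda phi alpha (c *: phi n) =
  ((- lambda n) `^ alpha)%:C *: (c *: phi n).
Proof.
apply: norm_lim_near_cst.
by exists n.+1 => // m /= nm; exact: frac_pow_series_eigen.
Qed.

Section Mode.
Variables (n : nat) (x y : R).
(** Real and imaginary parts of z + eps mu^alpha = - mu e^{- z tau}, for z = x + iy and mu = -
    lambda_n. *)
Hypothesis char_Re : x + eps * (- lambda n) `^ alpha =
  - - lambda n * expR (- (x * tau)) * cos (y * tau).
Hypothesis char_Im :
  y = - lambda n * expR (- (x * tau)) * sin (y * tau).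

Definition exp_mode (t : R) : X := (Re_exp x y t +i* Im_exp x y t) *: phi n.

(** The coefficient obtained is z e^{zt}, that is, the derivative of the mode: this is where the
    characteristic equation enters. *)
Lemma delay_rhs_exp_mode t :
  delay_rhs dot A lambda phi tau eps alpha exp_mode t =
  ((x * Re_exp x y t - y * Im_exp x y t) +i*
   (y * Re_exp x y t + x * Im_exp x y t)) *: phi n.
Proof.
rewrite /delay_rhs /exp_mode frac_pow_eigen opZ; last exact: (heig n).1.
rewrite (heig n).2 !scalerA -scalerBl; congr (_ *: _).
rewrite /Re_exp /Im_exp !mulrBr cosB sinB expRD.
move: char_Re char_Im; rewrite opprK => /(canRL (addrK _)).
(* Exponentials and trigonometric values become variables first, so that substituting for x and y
   affects only the factor z; what remains is a polynomial identity. *)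
move: (expR (x * t)) (expR (- (x * tau))) (cos (y * t)) (sin (y * t)).
move: (cos (y * tau)) (sin (y * tau)) => c s E F C S -> ->.
by apply/eqP; rewrite eq_complex /=; apply/andP; split; apply/eqP; ring.
Qed.

Lemma rnorm_exp_mode t : rnorm (exp_mode t) = expR (x * t).
Proof.
rewrite rnormZ rnorm_orthonormal mulr1 /= /Re_exp /Im_exp !exprMn -mulrDr.
by rewrite cos2Dsin2 mulr1 sqrtr_sqr ger0_norm ?expR_ge0.
Qed.

Lemma exp_mode_solution :
  delay_solution dot A lambda phi tau eps alpha
    (exp_mode 0) exp_mode exp_mode.
Proof.
have phi0 : phi n != 0.
  apply/eqP => p0; have := rnorm_orthonormal n.
  by rewrite p0 rnorm0 => /esym/eqP; rewrite oner_eq0.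
have cR := @continuous_Re_exp R x y; have cI := @continuous_Im_exp R x y.
(* The mode is given by one formula on the whole line, so an arbitrary interval covers both the
   history on (-tau, 0) and the solution on (0, T). *)
have L2mode p q : bochner_L2 `]p, q[ (dom A) (graph_norm A) exp_mode.
  apply: bochner_L2_scaler => //.
  - by move=> c; apply: domZ; exact: (heig n).1.
  - by move=> c; apply: graph_normZ; exact: (heig n).1.
  - exact: graph_norm_ge0.
split=> //.
- by apply: dom_real_interpolation; apply: domZ; exact: (heig n).1.
- by apply: continuous_subspaceT; exact: scaler_complex_continuous.
- move=> t t0; split.
  + by apply: domZ; exact: (heig n).1.
  + exact: frac_pow_dom_eigen.
  + rewrite delay_rhs_exp_mode; apply: scaler_complex_derivative.
      exact: is_derive_Re_exp.
    exact: is_derive_Im_exp.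
- move=> T T0; rewrite (funext delay_rhs_exp_mode).
  apply: bochner_L2_scaler => //.
  - by move=> c; rewrite rnormZ.
  - exact: rnorm_ge0.
  - move=> t; apply: cvgB; apply: cvgM; try exact: cvg_cst.
      exact: cR.
    exact: cI.
  - move=> t; apply: cvgD; apply: cvgM; try exact: cvg_cst.
      exact: cR.
    exact: cI.
Qed.

(** The norm e^{xt} is at most 1 on the history interval, whose length is tau, and equals 1 at t =
    0. The bound depends on neither n nor z. *)
Lemma data_norm_exp_mode : 0 <= x -> 0 < tau ->
  (data_norm tau (exp_mode 0) exp_mode <= ((1 + tau) `^ 2^-1)%:E)%E.
Proof.
move=> x0 tau0; rewrite /data_norm -poweR_EFin.
have int_le : (\int[lebesgue_measure]_(t in `](- tau)%R, 0%R[)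
    ((rnorm (exp_mode t) ^+ 2)%R)%:E <= tau%:E)%E.
  apply: (@le_trans _ _
      (\int[lebesgue_measure]_(t in `](- tau)%R, 0%R[) (cst 1%:E t))%E).
    apply: ge0_le_integral => //=.
    - by move=> t _; rewrite lee_fin sqr_ge0.
    - apply/measurable_EFinP; apply: measurable_funTS.
      apply: (eq_measurable_fun (fun t => expR (x * t) ^+ 2)) => [t _|].
        by rewrite rnorm_exp_mode.
      apply: measurable_funX; apply: measurableT_comp => //.
    - move=> t; rewrite in_itv/= => /andP[_ t0]; rewrite lee_fin rnorm_exp_mode.
      rewrite expr_le1// ?expR_ge0// expR_le1.
      by rewrite mulr_ge0_le0// ltW.
  rewrite integral_cst//= mul1e lebesgue_measure_itv /= lte_fin oppr_lt0 tau0.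
  by rewrite -EFinD opprK add0r.
have int_ge0 : (0 <= \int[lebesgue_measure]_(t in `](- tau)%R, 0%R[)
    ((rnorm (exp_mode t) ^+ 2)%R)%:E)%E.
  by apply: integral_ge0 => t _; rewrite lee_fin sqr_ge0.
apply: gt0_ler_poweR => //.
- by rewrite in_itv/= leey andbT adde_ge0// lee_fin sqr_ge0.
- by rewrite in_itv/= leey andbT lee_fin addr_ge0// ltW.
by rewrite rnorm_exp_mode mulr0 expR0 expr1n EFinD leeD2l.
Qed.

End Mode.
End ExpMode.

(** * Ill-posedness from a sequence of modes *)

Theorem theorem26 (R : realType) (X : completeNormedModType R[i])
    (dot : {dot X for @Num.conj R[i]}) (hdot : induces_norm dot)
    (A : operator X) (hA : self_adjoint dot A)
    (hpos : negative_operator dot A)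
    (phi : nat -> X) (lambda : nat -> R)
    (hphi : complete_orthonormal dot phi)
    (heig : forall j, dom A (phi j) /\ A (phi j) = (lambda j)%:C *: phi j)
    (hlambda : lambda j @[j --> \oo] --> -oo)
    (tau eps alpha : R) (htau : 0 < tau) (heps : 0 < eps) (halpha : alpha < 1) :
  exists u : nat -> R -> X,
    [/\ forall j, delay_solution dot A lambda phi tau eps alpha
                    (u j 0) (u j) (u j),
        forall t : R, 0 < t -> rnorm (u j t) @[j --> \oo] --> +oo &
        exists M : R, forall j,
          (data_norm tau (u j 0%R) (u j) <= M%:E)%E].
Proof.
have mu_oo : - lambda j @[j --> \oo] --> +oo by apply/cvgNry.
pose b j := eps * (- lambda j) `^ alpha.
have b0 j : 0 <= b j by rewrite mulr_ge0 ?powR_ge0// ltW.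
have large M : \forall j \near \oo,
    (pi / tau + M + b j) * expR (M * tau) < - lambda j.
  by apply: near_powR_affine_lt => //; exact: expR_gt0.
(* With M = 0 the inequality reads pi / tau + b < mu, the condition for a root to exist. Shifting
   the indices by N makes it hold for every j. *)
have [N _ HN] := large 0.
pose n j := (j + N)%N.
have n_large j : (pi / tau + 0 + b (n j)) * expR (0 * tau) < - lambda (n j).
  by apply: HN => /=; exact: leq_addl.
have /choice[z hz] j : exists z : R * R,
    [/\ z.1 + b (n j) =
          - - lambda (n j) * expR (- (z.1 * tau)) * cos (z.2 * tau),
        z.2 = - lambda (n j) * expR (- (z.1 * tau)) * sin (z.2 * tau) &
        forall M, 0 <= M ->
          (pi / tau + M + b (n j)) * expR (M * tau) < - lambda (n j) ->
          M < z.1].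
  have [|x [y ?]] := @delay_characteristic_root R tau (b (n j)) (- lambda (n j)) htau (b0 _).
    by have := n_large j; rewrite mul0r expR0 mulr1 addr0.
  by exists (x, y).
exists (fun j => exp_mode phi (n j) (z j).1 (z j).2); split.
- by move=> j; have [hx hy _] := hz j; exact: exp_mode_solution.
- move=> t t0; apply/cvgryPge => B.
  (* Once x > B / t, one has B < x t <= e^{xt}; the maximum with 0 meets the requirement M >= 0 of
     the root estimate. *)
  have [K _ HK] := large (Num.max 0 (B / t)).
  exists K => // j /= Kj.
  rewrite (rnorm_exp_mode hdot hphi).
  have [_ _ hz3] := hz j.
  have : Num.max 0 (B / t) < (z j).1.
    by apply: hz3; [rewrite le_max lexx|apply: HK; exact: leq_trans (leq_addr _ _)].
  rewrite gt_max => /andP[_]; rewrite ltr_pdivrMr// => Bx.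
  by apply: (le_trans (ltW Bx)); apply: le_trans (expR_ge1Dx _); rewrite lerDr.
- exists ((1 + tau) `^ 2^-1) => j; apply: data_norm_exp_mode => //.
  (* The root estimate at M = 0 gives x > 0 for every j, as the uniform data bound requires. *)
  by have [_ _ hz3] := hz j; exact: ltW (hz3 0 (lexx 0) (n_large j)).
Qed.
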